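(* Let $F$ be a (non-empty) totally bounded set in a metric space. Then for all $\theta \in (0,1)$ we have \[ \dim_\mathrm{L} F \ \leq \ \dim_\mathrm{L}^\theta F \ \leq \ \underline{\dim}_\mathrm{B} F \] and \[ \dim_\mathrm{ML} F \ \leq \ \dim_\mathrm{ML}^\theta F \ \leq \ \underline{\dim}_\mathrm{B} F . \]
   Context: For a subset $E$ of a metric space and $r>0$, $N(E,r)$ denotes the minimal number of balls of radius $r$ required to cover $E$, and $B(x,R)$ is the ball of radius $R$ centred at $x$. The lower dimension of $F$ is \[ \dim_{\mathrm L} F = \sup\Big\{\alpha : \exists C>0,\ \exists \rho>0,\ \forall\, 0<r<R\leq\rho,\ \forall x\in F,\ N(B(x,R)\cap F,r)\geq C (R/r)^{\alpha}\Big\}, \] and the modified lower dimension is $\dim_{\mathrm{ML}}F=\sup\{\dim_{\mathrm L}E : \emptyset\neq E\subseteq F\}$. For $\theta\in(0,1)$, the lower spectrum of $F$ at $\theta$ is \[ \dim_{\mathrm L}^{\theta} F = \sup\Big\{\alpha : \exists C>0,\ \exists \rho>0,\ \forall\, 0<R\leq\rho,\ \forall x\in F,\ N(B(x,R)\cap F,R^{1/\theta})\geq C \big(R/R^{1/\theta}\big)^{\alpha}\Big\}, \] and the modified lower spectrum is $\dim_{\mathrm{ML}}^{\theta}F=\sup\{\dim_{\mathrm L}^{\theta}E : \emptyset\neq E\subseteq F\}$. The lower box dimension of a totally bounded set $F$ is $\underline{\dim}_{\mathrm B}F=\liminf_{R\to0}\frac{\log N(F,R)}{-\log R}$. *)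

(* Defs.v *)
From mathcomp Require Import all_boot all_order all_algebra finmap.
From mathcomp Require Import all_classical all_reals all_analysis.

Set Implicit Arguments.
Unset Strict Implicit.
Unset Printing Implicit Defensive.

Import Order.TTheory GRing.Theory Num.Theory.
Import numFieldTopology.Exports numFieldNormedType.Exports.

Local Open Scope classical_set_scope.
Local Open Scope ring_scope.

Section dimensions.
Context {R : realType} {X : metricType R}.
Implicit Types (E F : set X) (r s theta : R).

Definition totally_bounded F :=
  forall r, 0 < r -> finite_subset_cover [set: X] (fun x => ball x r) F.

(* Balls are open, and the centres of a cover range over the whole space X
   rather than E. The value is +oo when E has no finite cover by r-balls. *)
Definition covering_number E r : \bar R :=
  ereal_inf [set (#|` D|)%:R%:E |
    D in [set D : {fset X} | E `<=` cover [set` D] (fun x => ball x r)]].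

(* The dimensions are suprema in \bar R, since they may be infinite even for
   compact sets. *)
Definition lower_dim F : \bar R :=
  ereal_sup [set alpha%:E | alpha in [set alpha : R |
    exists C rho : R, [/\ 0 < C, 0 < rho &
      forall r s, 0 < r -> r < s -> s <= rho -> forall x, F x ->
        ((C * (s / r) `^ alpha)%:E <=
          covering_number (ball x s `&` F) r)%E]]].

Definition lower_spectrum theta F : \bar R :=
  ereal_sup [set alpha%:E | alpha in [set alpha : R |
    exists C rho : R, [/\ 0 < C, 0 < rho &
      forall s, 0 < s -> s <= rho -> forall x, F x ->
        ((C * (s / s `^ (1 / theta)) `^ alpha)%:E <=
          covering_number (ball x s `&` F) (s `^ (1 / theta)))%E]]].

Definition modified_lower_dim F : \bar R :=
  ereal_sup [set lower_dim E | E in [set E | E !=set0 /\ E `<=` F]].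

Definition modified_lower_spectrum theta F : \bar R :=
  ereal_sup
    [set lower_spectrum theta E | E in [set E | E !=set0 /\ E `<=` F]].

Definition lower_box_dim F : \bar R :=
  limf_einf (fun r : R => (lne (covering_number F r) / (- ln r)%:E)%E) 0^'+.

End dimensions.

(* Main.v *)
Require Import Defs.
From mathcomp Require Import all_boot all_order all_algebra.
From mathcomp Require Import all_classical all_reals all_analysis.
From mathcomp Require Import finmap lra zify.

Set Implicit Arguments.
Unset Strict Implicit.
Unset Printing Implicit Defensive.

Import Order.TTheory GRing.Theory Num.Theory.
Import numFieldTopology.Exports numFieldNormedType.Exports.

Local Open Scope classical_set_scope.
Local Open Scope ring_scope.

(** The lower dimension tests all pairs of scales r < s and the lower spectrum
    only the pairs with r = s `^ (1 / theta), which gives the first inequality.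

    For the second one, suppose that every covering number of ball x s `&` F at
    scale r = s `^ (1 / theta) is at least C * (s / r) `^ alpha. Applied to F at
    the single scale r this only bounds the exponent of growth of
    N(r) := covering_number F r by (1 - theta) * alpha from below. To recover the
    missing part, F is split at scale s: it contains at least N(4 * s) points at
    mutual distance at least 4 * s, and no ball of radius r serves two of the
    balls of radius s around them (exists_coarse_cover), so
      N(r) >= N(4 * s) * C * (s / r) `^ alpha, with s = r `^ theta.
    Instead of iterating this over the scales r `^ (theta ^+ n), take the lower
    limit b of ln N(r) / - ln r on both sides: since - ln s = theta * - ln r,
      b >= theta * b + (1 - theta) * alpha,
    that is b >= alpha, unless b is infinite, when nothing is left to prove
    (limf_einf_scaling).

    The inequalities for the modified dimensions follow by taking suprema over
    the nonempty subsets E of F, as the lower box dimension is monotone. *)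

(** * Lower limits along a filter *)

Section limf_einf_filter.
Context {T : choiceType} {Y : filteredType T} {R : realType}.
Context (G : set_system Y) {FG : Filter G}.
Implicit Types f g : Y -> \bar R.

Lemma limf_einf_ge f (b : \bar R) :
  (\forall x \near G, (b <= f x)%E) -> (b <= limf_einf f G)%E.
Proof.
move=> bf; rewrite limf_einfE; apply: ereal_sup_ge.
pose V := [set x | (b <= f x)%E].
exists (ereal_inf (f @` V)); first by exists V.
by apply: le_ereal_inf_tmp => _ [x /= bfx <-].
Qed.

Lemma near_lt_limf_einf f (b : \bar R) :
  (b < limf_einf f G)%E -> \forall x \near G, (b <= f x)%E.
Proof.
rewrite limf_einfE => /ereal_sup_gt[_ [V GV <-] bV].
apply: filterS GV => x Vx; apply: le_trans (ltW bV) _.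
by apply: ereal_inf_lbound; exists x.
Qed.

Lemma le_limf_einf f g :
  (\forall x \near G, (f x <= g x)%E) -> (limf_einf f G <= limf_einf g G)%E.
Proof.
move=> fg; rewrite [leLHS]limf_einfE; apply: ge_ereal_sup => _ [V GV <-].
apply: limf_einf_ge; apply: filterS2 GV fg => x Vx; apply: le_trans.
by apply: ereal_inf_lbound; exists x.
Qed.

End limf_einf_filter.

(** * A recursive inequality between the scales r and k * r `^ theta *)

Section self_improvement.
Context {R : realType}.

Lemma near0_ln_lt (M : R) : \forall r \near 0^'+, ln r < M.
Proof. by move/cvgrNy_lt : (@lnNy R); apply. Qed.

Lemma cvg_mul_powR_at_right0 (theta k : R) : 0 < theta -> 0 < k ->
  k * r `^ theta @[r --> 0^'+] --> 0^'+.
Proof.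
move=> th0 k0 A [d /= d0 dA].
have : k * r `^ theta @[r --> 0^'+] --> k * 0.
  by apply: cvgMl_tmp; exact: powR_cvg0.
rewrite mulr0 => /cvgrPdist_lt /(_ _ d0) Hd.
suff : \forall r \near 0^'+, A (k * r `^ theta) by [].
near=> r; apply: dA; first by near: r.
by apply: mulr_gt0 => //; apply: powR_gt0; near: r; exact: nbhs_right_gt.
Unshelve. all: by end_near. Qed.

(** Write b for the lower limit, assumed finite and below alpha, and l for
    - ln r. At the scale k * r `^ theta, where - ln is theta * l - ln k, the
    values of g are at least (b - e) * (theta * l - ln k) for small r. The
    recursive inequality then bounds g r / l from below by
    theta * b + (1 - theta) * alpha, up to terms that are small with e and 1 / l.
    As this is a proper average of b and alpha, it exceeds b. *)
Lemma limf_einf_scaling (g : R -> R) (theta alpha k c : R) :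
  0 < theta -> theta < 1 -> 0 < k ->
  (\forall r \near 0^'+, 0 <= g r) ->
  (\forall r \near 0^'+,
     g (k * r `^ theta) + (1 - theta) * alpha * - ln r - c <= g r) ->
  (alpha%:E <= limf_einf (fun r => (g r / - ln r)%:E) 0^'+)%E.
Proof.
move=> th0 th1 k0 g0 grec.
set beta := limf_einf _ _.
have beta0 : (0 <= beta)%E.
  apply: limf_einf_ge; near=> r; rewrite lee_fin divr_ge0 //.
    by near: r.
  by rewrite oppr_ge0 ltW//; near: r; exact: near0_ln_lt.
rewrite leNgt; apply/negP => ba.
have betaE : beta = (fine beta)%:E.
  by rewrite fineK// ge0_fin_numE// (lt_trans ba)// ltry.
move: ba; rewrite betaE lte_fin; set b := fine beta => ba.
(* A quarter of the gain (1 - theta) * (alpha - b) of the average over b; the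
   two losses below, theta * e and e, amount to less than half of it. *)
pose e := (1 - theta) * (alpha - b) / 4.
have e0 : 0 < e by rewrite divr_gt0// mulr_gt0// subr_gt0.
have near_g : \forall r \near 0^'+, (b - e) * - ln r <= g r.
  have : ((b - e)%:E < beta)%E by rewrite betaE lte_fin -/b; lra.
  move/near_lt_limf_einf => H; near=> r.
  have : ((b - e)%:E <= (g r / - ln r)%:E)%E by near: r.
  by rewrite lee_fin ler_pdivlMr// oppr_gt0; near: r; exact: near0_ln_lt.
have scale0 := cvg_mul_powR_at_right0 th0 k0.
have near_g' : \forall r \near 0^'+,
    (b - e) * - ln (k * r `^ theta) <= g (k * r `^ theta).
  exact: (scale0 _ near_g).
have : ((theta * (b - e) + (1 - theta) * alpha - e)%:E <= beta)%E.
  apply: limf_einf_ge; near=> r.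
  have r0 : 0 < r by near: r; exact: nbhs_right_gt.
  have lnr : ln r < 0 by near: r; exact: near0_ln_lt.
  rewrite lee_fin ler_pdivlMr ?oppr_gt0//.
  have h1 : g (k * r `^ theta) + (1 - theta) * alpha * - ln r - c <= g r.
    by near: r.
  have h2 : (b - e) * - ln (k * r `^ theta) <= g (k * r `^ theta) by near: r.
  apply: le_trans h1; move: h2; rewrite lnM ?posrE ?powR_gt0// ln_powR.
  (* The threshold makes e * - ln r absorb the constants k and c. *)
  have h3 : ln r < - (((b - e) * ln k + c) / e).
    by near: r; exact: near0_ln_lt.
  move: h3; rewrite ltrNr ltr_pdivrMr//.
  nra.
rewrite betaE lee_fin -/b leNgt => /negP; apply.
have e4 : 4 * e = (1 - theta) * (alpha - b) by rewrite /e mulrC divfK ?pnatr_eq0.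
have : theta * e < e by rewrite gtr_pMl.
lra.
Unshelve. all: by end_near. Qed.

End self_improvement.

(** * Counting balls at two scales *)

Section covering.
Context {R : realType} {X : metricType R}.
Implicit Types (E F : set X) (r s m : R) (D A : {fset X}).

Notation ballcover D r := (cover [set` D] (fun x => ball x r)).

Lemma covering_number_le E r D :
  E `<=` ballcover D r -> (covering_number E r <= (#|` D|)%:R%:E)%E.
Proof. by move=> ED; apply: ereal_inf_lbound; exists D. Qed.

Lemma covering_number_attained E r D : E `<=` ballcover D r ->
  exists2 A, E `<=` ballcover A r & covering_number E r = (#|` A|)%:R%:E.
Proof.
move=> ED.
pose P n := `[< exists2 A, E `<=` ballcover A r & #|` A| = n >].
have exP : exists n, P n by exists #|` D|; apply/asboolP; exists D.
case: (ex_minnP exP) => n /asboolP[A EA An] minn; exists A => //.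
apply/eqP; rewrite eq_le covering_number_le//=.
apply: le_ereal_inf_tmp => _ [B EB <-].
by rewrite lee_fin ler_nat An minn//; apply/asboolP; exists B.
Qed.

Lemma covering_number_subset E F r :
  E `<=` F -> (covering_number E r <= covering_number F r)%E.
Proof.
move=> EF; apply: le_ereal_inf => _ [D FD <-].
by exists D => //; exact: subset_trans FD.
Qed.

(** A ball of radius r <= s cannot meet ball x s and ball y s when x and y are
    4 * s apart. Hence, extracting greedily from F points that are 4 * s apart,
    each uses up at least m balls of D for itself, and when the extraction stops
    the balls of radius 4 * s around these points cover F. The induction is on
    the number of balls of D not yet used. *)
Lemma exists_coarse_cover F r s m D : 0 < s -> r <= s -> 0 <= m ->
  (forall x, F x -> (m%:E <= covering_number (ball x s `&` F) r)%E) ->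
  F `<=` ballcover D r ->
  exists2 A, F `<=` ballcover A (4 * s) & (#|` A|)%:R * m <= (#|` D|)%:R.
Proof.
move=> s0 rs m0 Fm FD.
(* Only the balls around points of E need to be covered, which lets E and D
   shrink together. *)
suff H n : forall D E, (#|` D| < n)%N -> E `<=` F ->
    (forall x, E x -> ball x s `&` F `<=` ballcover D r) ->
    exists2 A, E `<=` ballcover A (4 * s) & (#|` A|)%:R * m <= (#|` D|)%:R.
  by apply: (H _ D F (ltnSn _)) => // x Fx y [_ /FD].
elim: n => [//|n IH] {FD}D E Dn EF ED.
have [[x Ex]|E0] := pselect (E !=set0); last first.
  by exists fset0; [move=> x Ex; case: E0; exists x | rewrite cardfs0 mul0r].
have Fx := EF _ Ex.
have [d dD dx] : ballcover D r x.
  by apply: (ED x) => //; split => //; exact: ballxx.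
(* D1 consists of the centres whose balls reach ball x s; they pay for x. *)
pose D1 := [fset d in D | `[< (ball x s `&` F) `&` ball d r !=set0 >]]%fset.
pose D' := (D `\` D1)%fset.
have D1P e : e \in D1 =
    (e \in D) && `[< (ball x s `&` F) `&` ball e r !=set0 >].
  by rewrite !inE.
have D1D : (D1 `<=` D)%fset by apply/fsubsetP => e; rewrite D1P => /andP[].
have dD1 : d \in D1.
  rewrite D1P; apply/andP; split => //; apply/asboolP; exists x.
  by do !split => //; exact: ballxx.
have cardD : #|` D| = (#|` D1| + #|` D'|)%N.
  by rewrite /D' cardfsDS// subnKC// fsubset_leq_card.
have mD1 : m <= (#|` D1|)%:R.
  rewrite -lee_fin; apply: le_trans (Fm x Fx) _.
  apply: covering_number_le => y [xy Fy].
  have [e eD ey] := ED x Ex y (conj xy Fy).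
  exists e => //; rewrite /= D1P; apply/andP; split => //.
  by apply/asboolP; exists y.
have D'n : (#|` D'| < n)%N.
  have : (0 < #|` D1|)%N by rewrite cardfs_gt0; apply/fset0Pn; exists d.
  by move: Dn; rewrite cardD; lia.
have [||A EA Am] := IH D' (E `\` ball x (4 * s)) D'n.
- by move=> y [Ey _]; exact: EF.
- move=> y [Ey xy] z [yz Fz].
  have [e eD ez] := ED y Ey z (conj yz Fz).
  exists e => //; rewrite /= inE eD andbT; apply/negP.
  rewrite D1P => /andP[_ /asboolP[w [[xw _] ew]]].
  (* A ball meeting both ball x s and ball y s would put y within
     s + 2 * r + s <= 4 * s of x. *)
  apply: xy; apply: (@le_ball _ _ _ (s + r + r + s)); first by lra.
  apply: (@ball_triangle _ _ z); last exact: ball_sym.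
  apply: (@ball_triangle _ _ e) => //.
  by apply: (@ball_triangle _ _ w) => //; exact: ball_sym.
- exists (x |` A)%fset.
    move=> y Ey; have [xy|xy] := pselect (ball x (4 * s) y).
      by exists x => //; rewrite /= !inE eqxx.
    have [a aA ay] := EA y (conj Ey xy).
    by exists a => //; rewrite /= !inE; apply/orP; right.
  rewrite cardD natrD; apply: le_trans (lerD mD1 Am).
  rewrite -[X in X + _ * m]mul1r -mulrDl -(natrD _ 1%N) ler_wpM2r// ler_nat.
  by rewrite cardfsU1 leq_add2r; case: (_ \notin _).
Qed.

End covering.

(** * Comparison of the dimensions *)

Section spectrum.
Context {R : realType} {X : metricType R}.
Implicit Types (E F : set X).

Lemma totally_bounded_subset E F :
  E `<=` F -> totally_bounded F -> totally_bounded E.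
Proof.
move=> EF Ftb r r0; have [D DT FD] := Ftb r r0.
by exists D => //; exact: subset_trans FD.
Qed.

Lemma covering_number_nat F r : totally_bounded F -> 0 < r ->
  exists2 D : {fset X}, F `<=` cover [set` D] (fun x => ball x r) &
    covering_number F r = (#|` D|)%:R%:E.
Proof.
by move=> Ftb r0; have [D _] := Ftb r r0; exact: covering_number_attained.
Qed.

Lemma covering_number_fin F r : F !=set0 -> totally_bounded F -> 0 < r ->
  covering_number F r = (fine (covering_number F r))%:E /\
  1 <= fine (covering_number F r).
Proof.
move=> [x Fx] Ftb r0; have [D FD ->] := covering_number_nat Ftb r0; split => //=.
rewrite ler1n cardfs_gt0; apply/fset0Pn.
by have [d dD _] := FD x Fx; exists d.
Qed.

(** For s < 1 the pair s `^ (1 / theta) < s is one of the pairs of scales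
    r < s in the definition of the lower dimension. *)
Lemma lower_dim_le_lower_spectrum (theta : R) F : 0 < theta -> theta < 1 ->
  (lower_dim F <= lower_spectrum theta F)%E.
Proof.
move=> th0 th1; apply: le_ereal_sup => _ [alpha [C [rho [C0 rho0 H]]] <-].
exists alpha => //; exists C, (Num.min rho (1 / 2)); split => //.
  by rewrite lt_min rho0/=; lra.
move=> s s0; rewrite le_min => /andP[srho s1] x Fx.
apply: H => //; first exact: powR_gt0.
have lns : ln s < 0 by apply: ln_lt0; lra.
rewrite -ltr_ln ?posrE ?powR_gt0// ln_powR gtr_nMl// div1r invf_gt1//.
Qed.

(** With s = r `^ theta, the counting lemma turns the lower bound
    C * (s / r) `^ alpha on local covering numbers into
    C * (s / r) `^ alpha * covering_number F (4 * s) <= covering_number F r,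
    whose logarithm is the recursive inequality of limf_einf_scaling. *)
Lemma lower_spectrum_le_lower_box_dim (theta : R) F :
  0 < theta -> theta < 1 -> F !=set0 -> totally_bounded F ->
  (lower_spectrum theta F <= lower_box_dim F)%E.
Proof.
move=> th0 th1 F0 Ftb; apply: ge_ereal_sup => _ [alpha [C [rho [C0 rho0 H]]] <-].
pose N (r : R) := fine (covering_number F r).
have NE r : 0 < r -> covering_number F r = (N r)%:E.
  by move=> r0; have [] := covering_number_fin F0 Ftb r0.
have N1 r : 0 < r -> 1 <= N r.
  by move=> r0; have [] := covering_number_fin F0 Ftb r0.
have k0 : (0 : R) < 4 by lra.
apply: (@le_trans _ _ (limf_einf (fun r => (ln (N r) / - ln r)%:E) 0^'+)); last first.
  apply: le_limf_einf; near=> r.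
  have r0 : 0 < r by near: r; exact: nbhs_right_gt.
  have lnr : ln r < 0 by near: r; exact: near0_ln_lt.
  rewrite NE// lne_EFin ?(lt_le_trans _ (N1 _ r0))// inver oppr_eq0 lt_eqF//.
apply: (@limf_einf_scaling _ (fun r => ln (N r)) theta alpha 4 (- ln C)) => //.
  by near=> r => /=; apply: ln_ge0; apply: N1; near: r; exact: nbhs_right_gt.
have small : \forall r \near 0^'+, 1 * r `^ theta < rho.
  exact: (cvg_mul_powR_at_right0 th0 ltr01 (nbhs_right_lt rho0)).
near=> r => /=.
have r0 : 0 < r by near: r; exact: nbhs_right_gt.
have r1 : r <= 1 by near: r; apply: nbhs_right_le; exact: ltr01.
set s := r `^ theta.
have s0 : 0 < s by exact: powR_gt0.
have srho : s <= rho.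
  by apply: ltW; rewrite -[s]mul1r /s; near: r; exact: small.
have sr : s `^ (1 / theta) = r.
  by rewrite -powRrM mulrCA divff ?gt_eqF// mulr1 powRr1 ?ltW.
have rs : r <= s.
  by rewrite -[leLHS]powRr1 ?(ltW r0)// ger_powR ?r0//; exact: ltW.
pose m := C * (s / r) `^ alpha.
have m0 : 0 < m by rewrite mulr_gt0// powR_gt0// divr_gt0.
have Fm x : F x -> (m%:E <= covering_number (ball x s `&` F) r)%E.
  by move=> Fx; have := H s s0 srho x Fx; rewrite sr.
have [D FD DE] := covering_number_nat Ftb r0.
have [A FA Am] := exists_coarse_cover s0 rs (ltW m0) Fm FD.
have NA : N (4 * s) * m <= N r.
  have -> : N r = (#|` D|)%:R by rewrite /N DE.
  apply: le_trans Am; rewrite ler_pM2r// -lee_fin -NE ?mulr_gt0//.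
  exact: covering_number_le.
have N40 : 0 < N (4 * s) by rewrite (lt_le_trans _ (N1 _ _))// mulr_gt0.
have : ln (N (4 * s) * m) <= ln (N r).
  have Nr0 : 0 < N r by exact: lt_le_trans ltr01 (N1 _ r0).
  by rewrite ler_ln ?posrE//; exact: mulr_gt0.
rewrite lnM ?posrE// lnM ?posrE ?powR_gt0 ?divr_gt0// ln_powR ln_div ?posrE//.
rewrite /s ln_powR; lra.
Unshelve. all: by end_near. Qed.

Lemma lower_box_dim_subset E F : E !=set0 -> totally_bounded F -> E `<=` F ->
  (lower_box_dim E <= lower_box_dim F)%E.
Proof.
move=> E0 Ftb EF; apply: le_limf_einf; near=> r.
have r0 : 0 < r by near: r; exact: nbhs_right_gt.
have lnr : ln r < 0 by near: r; exact: near0_ln_lt.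
rewrite inver oppr_eq0 lt_eqF//.
have lnr' : (0 <= (- ln r)^-1%:E)%E by rewrite lee_fin invr_ge0 oppr_ge0 ltW.
apply: lee_wpmul2r => //.
have [NE NE1] := covering_number_fin E0 (totally_bounded_subset EF Ftb) r0.
have [NF NF1] := covering_number_fin (subset_nonempty EF E0) Ftb r0.
have := covering_number_subset r EF; rewrite NE NF lee_fin => EFr.
rewrite !lne_EFin ?(lt_le_trans ltr01)// lee_fin ler_ln ?posrE//.
all: exact: lt_le_trans ltr01 _.
Unshelve. all: by end_near. Qed.

Lemma modified_lower_dim_le_modified_lower_spectrum (theta : R) F :
  0 < theta -> theta < 1 ->
  (modified_lower_dim F <= modified_lower_spectrum theta F)%E.
Proof.
move=> th0 th1; apply: ge_ereal_sup => _ [E EF <-].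
apply: le_trans (lower_dim_le_lower_spectrum E th0 th1) _.
by apply: ereal_sup_ubound; exists E.
Qed.

Lemma modified_lower_spectrum_le_lower_box_dim (theta : R) F :
  0 < theta -> theta < 1 -> totally_bounded F ->
  (modified_lower_spectrum theta F <= lower_box_dim F)%E.
Proof.
move=> th0 th1 Ftb; apply: ge_ereal_sup => _ [E [E0 EF] <-].
apply: le_trans (lower_box_dim_subset E0 Ftb EF).
by apply: lower_spectrum_le_lower_box_dim => //; exact: totally_bounded_subset Ftb.
Qed.

End spectrum.

Theorem proposition3p9 (R : realType) (X : metricType R) (F : set X)
    (F_nonempty : F !=set0) (F_tb : totally_bounded F)
    (theta : R) (theta_gt0 : 0 < theta) (theta_lt1 : theta < 1) :
  ((lower_dim F <= lower_spectrum theta F)%E /\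
   (lower_spectrum theta F <= lower_box_dim F)%E) /\
  ((modified_lower_dim F <= modified_lower_spectrum theta F)%E /\
   (modified_lower_spectrum theta F <= lower_box_dim F)%E).
Proof.
split; split.
- exact: lower_dim_le_lower_spectrum.
- exact: lower_spectrum_le_lower_box_dim.
- exact: modified_lower_dim_le_modified_lower_spectrum.
- exact: modified_lower_spectrum_le_lower_box_dim.
Qed.
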